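(* Let $p$ be a prime. Then there are group isomorphisms $$\mathbb{Z}_p \cong \mathrm{Ext}(\mathbb{Z}(p^\infty), \mathbb{Z}) \quad\text{and}\quad \mathbb{Z}_p/\mathbb{Z} \cong \mathrm{Ext}(\mathbb{Z}[1/p], \mathbb{Z})$$ that are computable as functions between represented sets (in the sense of Weihrauch's computable analysis, with the representations given in the context).
   Context: All groups are abelian. $\mathbb{Z}_p$ is the additive group of $p$-adic integers, $\mathbb{Z}[1/p]$ is the additive group of rationals whose denominator is a power of $p$, and $\mathbb{Z}(p^\infty)=\mathbb{Z}[1/p]/\mathbb{Z}$ is the Prüfer group. The groups $\mathbb{Z}$, $\mathbb{Z}[1/p]$, $\mathbb{Z}(p^\infty)$ are countable and carry their standard computable presentations. Cocycles and Ext. For groups $C,A$, a cocycle is a function $f\colon C\times C\to A$ that is symmetric and satisfies $f(u,v)+f(u+v,w)=f(v,w)+f(u,v+w)$ for all $u,v,w\in C$; one may assume cocycles are normalized, i.e. $f(0,0)=0$. The cocycles form a group $Z(C,A)$ under pointwise addition. A coboundary is a cocycle of the form $g(u,v)=\varphi(u)+\varphi(v)-\varphi(u+v)$ for a function $\varphi\colon C\to A$ with $\varphi(0)=0$; the coboundaries form a subgroup $B(C,A)$. Put $\mathrm{Ext}(C,A)=Z(C,A)/B(C,A)$ (for normalized cocycles). Represented sets. A representation of a set $X$ is an onto map $\delta$ from a subset of $\Sigma^\omega$ to $X$, where $\Sigma$ is a (possibly infinite countable) alphabet; if $\delta(\alpha)=x$ then $\alpha$ is called a $\delta$-name of $x$.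 A function $F\colon X\to X'$ between represented sets $(X,\delta,\Sigma)$, $(X',\delta',\Sigma')$ is computable if there is an oracle Turing machine $M$ such that for each $\delta$-name $\alpha$, the output $M^\alpha$ is a $\delta'$-name and $F(\delta(\alpha))=\delta'(M^\alpha)$. Representations used. Names of elements of $\mathbb{Z}_p$ are sequences $\alpha\in\mathbb{Z}^\omega$, with $\alpha$ naming $\sum_n \alpha(n)p^n$; a name of an element of $\mathbb{Z}_p/\mathbb{Z}$ is a name of any representative in $\mathbb{Z}_p$. A name of an element of $\mathrm{Ext}(C,A)$, for computable countable $C,A$, is any cocycle in $Z(C,A)$ representing it (viewed as a sequence of elements of $A$ via a computable enumeration of $C\times C$). *)

(* Defs.v *)
From HB Require Import structures.
From Stdlib Require Cantor Relation_Operators.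
From mathcomp Require Import all_boot all_order all_algebra.
From mathcomp Require Import ring_quotient boolp functions.

Set Implicit Arguments.
Unset Strict Implicit.
Unset Printing Implicit Defensive.

Import GRing.Theory Num.Theory.
Local Open Scope ring_scope.

(** A machine has finitely many two-way infinite tapes. The head of a tape never
  moves along the integer coordinates: coordinate 0 is always the scanned cell,
  and it is the contents that are shifted. Letters of a countable, possibly
  infinite, alphabet are handled through their numerical codes, and a number n
  is written on a tape in unary, as a block of n marks that starts at the
  scanned cell. *)

Inductive direction := Left | Stay | Right.

Record machine := Machine {
  state : finType;
  symbol : finType;
  tape : finType;
  blank : symbol;
  mark : symbol;
  mark_neq_blank : mark != blank;
  start : state;
  query : state;
  answer : state;
  halt : state;
  input_tape : tape;
  oracle_tape : tape;
  output_tape : tape;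
  transition : state -> {ffun tape -> symbol} ->
    state * {ffun tape -> symbol * direction}
}.

Section Machine.
Variable M : machine.

Definition contents := int -> symbol M.

Definition config := (state M * (tape M -> contents))%type.

Definition write_move (t : contents) (a : symbol M * direction) : contents :=
  let w z := if z == 0 then a.1 else t z in
  match a.2 with
  | Left => fun z => w (z - 1)
  | Stay => w
  | Right => fun z => w (z + 1)
  end.

Definition block (n : nat) : contents :=
  fun z => if (0 <= z) && (z < n%:Z) then mark M else blank M.

Definition reads (t : contents) (n : nat) : Prop :=
  (forall i : nat, (i < n)%N -> t i%:Z = mark M) /\ t n%:Z <> mark M.

(** In the query state, the number n on the oracle tape is replaced by the
  value of the oracle at n. *)
Inductive step (oracle : nat -> nat) : config -> config -> Prop :=
| step_transition s t of s != halt M & s != query M :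
    let r := transition s [ffun i => t i 0] in
    step oracle (s, t) (r.1, fun i => write_move (t i) (r.2 i))
| step_query t n of query M != halt M & reads (t (oracle_tape M)) n :
    step oracle (query M, t)
      (answer M,
       fun i => if i == oracle_tape M then block (oracle n) else t i).

Definition initial (n : nat) : config :=
  (start M, fun i => if i == input_tape M then block n else block 0).

Definition outputs (oracle : nat -> nat) (n m : nat) : Prop :=
  exists2 t, Relation_Operators.clos_refl_trans_1n _ (step oracle)
               (initial n) (halt M, t)
           & reads (t (output_tape M)) m.

End Machine.

Record coding (S : Type) := Coding {
  code :> S -> nat;
  code_inj : injective code
}.

(** The partial onto map from sequences of letters to [X] is given by its
  graph [names]. *)
Record representation (X : Type) := Representation {
  alphabet : Type;
  letter_code : coding alphabet;
  names : (nat -> alphabet) -> X -> Prop;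
  names_fun : forall a x y, names a x -> names a y -> x = y;
  names_onto : forall x, exists a, names a x
}.

Arguments names {X} r.

(** Producing the infinite output sequence means producing its n-th letter on
  input n, for every n. *)
Definition computable (X Y : Type) (dX : representation X)
    (dY : representation Y) (F : X -> Y) : Prop :=
  exists M : machine, forall a x, names dX a x ->
    exists2 b, names dY b (F x)
      & forall n, outputs M (fun k => letter_code dX (a k)) n
                    (letter_code dY (b n)).

(** An isomorphism and its inverse are both required to be computable, so that
  neither direction of the isomorphism is privileged. *)
Definition computably_isomorphic (G H : zmodType) (dG : representation G)
    (dH : representation H) : Prop :=
  exists (F : {additive G -> H}) (F' : H -> G),
    [/\ cancel F F', cancel F' F, computable dG dH F & computable dH dG F'].

Section Ext.
Variables C A : zmodType.

Definition cocycle_pred : {pred C * C -> A} := fun f =>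
  `[< [/\ f (0, 0) = 0, forall u v, f (u, v) = f (v, u)
       & forall u v w, f (u, v) + f (u + v, w) = f (v, w) + f (u, v + w)] >].

Lemma cocycle_zmod_closed : zmod_closed cocycle_pred.
Proof.
split; first by apply/asboolP; split=> *; rewrite /= ?addr0.
move=> f g /asboolP[f0 fC fA] /asboolP[g0 gC gA]; apply/asboolP; split.
- by rewrite !fctE f0 g0 subr0.
- by move=> u v; rewrite !fctE fC gC.
- by move=> u v w; rewrite !fctE addrACA -opprD fA gA opprD addrACA.
Qed.

HB.instance Definition _ :=
  GRing.isZmodClosed.Build (C * C -> A) cocycle_pred cocycle_zmod_closed.

Record cocycle :=
  Cocycle { cocycle_val :> C * C -> A; _ : cocycle_val \in cocycle_pred }.
HB.instance Definition _ := [isSub for cocycle_val].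
HB.instance Definition _ := [Choice of cocycle by <:].
HB.instance Definition _ := [SubChoice_isSubZmodule of cocycle by <:].

Definition coboundary : {pred cocycle} := fun g =>
  `[< exists2 phi : C -> A, phi 0 = 0
        & forall u v, g (u, v) = phi u + phi v - phi (u + v) >].

Lemma coboundary_zmod_closed : zmod_closed coboundary.
Proof.
split.
  by apply/asboolP; exists (fun=> 0) => // u v; rewrite addr0 subr0.
move=> f g /asboolP[phi phi0 fE] /asboolP[psi psi0 gE]; apply/asboolP.
exists (fun u => phi u - psi u) => [|u v]; first by rewrite phi0 psi0 subr0.
have -> : (f - g) (u, v) = f (u, v) - g (u, v) by [].
rewrite fE gE [phi u - psi u + _]addrACA -opprD !opprB addrACA [RHS]addrACA.
by congr (_ + _); rewrite addrC.
Qed.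

HB.instance Definition _ :=
  GRing.isZmodClosed.Build cocycle coboundary coboundary_zmod_closed.

Definition Ext := Quotient.quot coboundary.
HB.instance Definition _ := GRing.Zmodule.on Ext.

Definition Ext_class (f : cocycle) : Ext := \pi_(Quotient.quot coboundary)%qT f.

End Ext.

(** Numberings may repeat elements: a name of a class in Ext is read through the
  numbering of pairs below, so that its values agree on the repetitions. *)
Record numbering (T : Type) := Numbering {
  element :> nat -> T;
  element_onto : forall x, exists n, element n = x
}.

Definition numbered_pair (T : Type) (nu : numbering T) (n : nat) : T * T :=
  let: (i, j) := Cantor.of_nat n in (nu i, nu j).

Section ExtRepresentation.
Variables (C A : zmodType) (nu : numbering C) (cA : coding A).

Definition Ext_names (a : nat -> A) (x : Ext C A) : Prop :=
  exists2 f : cocycle C A,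
    Ext_class f = x & forall n, a n = f (numbered_pair nu n).

Lemma Ext_names_fun a x y : Ext_names a x -> Ext_names a y -> x = y.
Proof.
move=> [f <- af] [g <- ag]; congr Ext_class; apply/val_inj/funext=> -[u v] /=.
have [i <-] := element_onto nu u; have [j <-] := element_onto nu v.
have := af (Cantor.to_nat (i, j)); rewrite ag.
by rewrite /numbered_pair Cantor.cancel_of_to => ->.
Qed.

Lemma Ext_names_onto x : exists a, Ext_names a x.
Proof.
exists (fun n => (repr x : cocycle C A) (numbered_pair nu n)).
by exists (repr x) => //; rewrite /Ext_class reprK.
Qed.

Definition Ext_representation : representation (Ext C A) :=
  Representation cA Ext_names_fun Ext_names_onto.

End ExtRepresentation.

Definition code_int (z : int) : nat :=
  match z with Posz n => n.*2 | Negz n => n.*2.+1 end.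

Definition decode_int (n : nat) : int :=
  if odd n then Negz n./2 else Posz n./2.

Lemma code_intK : cancel code_int decode_int.
Proof.
by case=> n; rewrite /decode_int /= odd_double /= ?uphalf_double ?doubleK.
Qed.

Definition int_coding : coding int := Coding (can_inj code_intK).

Section InvertP.
Variable p : nat.

Definition Zinv_pred : {pred rat} := fun x =>
  `[< exists (z : int) (n : nat), x = z%:~R / p%:R ^+ n >].

Lemma Zinv_zmod_closed : zmod_closed Zinv_pred.
Proof.
split; first by apply/asboolP; exists 0, 0%N; rewrite mul0r.
move=> _ _ /asboolP[z [n ->]] /asboolP[w [m ->]]; apply/asboolP.
have [p0|p_neq0] := eqVneq (p%:R : rat) 0.
  rewrite p0 !expr0n; exists (z *+ (n == 0%N) - w *+ (m == 0%N)), 0%N.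
  rewrite expr0 divr1 rmorphB !rmorphMn /=.
  by case: (n == _) (m == _) => -[]; rewrite ?mulr1n ?mulr0n ?invr1 ?invr0
    ?mulr1 ?mulr0.
exists (z * p%:Z ^+ m - w * p%:Z ^+ n), (n + m)%N.
rewrite rmorphB !rmorphM !rmorphXn /= exprD -[in LHS]mulNr addf_div ?expf_neq0 //.
by rewrite mulNr.
Qed.

HB.instance Definition _ :=
  GRing.isZmodClosed.Build rat Zinv_pred Zinv_zmod_closed.

Record Zinv := MkZinv { Zinv_val :> rat; _ : Zinv_val \in Zinv_pred }.
HB.instance Definition _ := [isSub for Zinv_val].
HB.instance Definition _ := [Choice of Zinv by <:].
HB.instance Definition _ := [SubChoice_isSubZmodule of Zinv by <:].

Definition integral : {pred Zinv} := fun x => (x : rat) \is a Num.int.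

Lemma integral_zmod_closed : zmod_closed integral.
Proof. by split=> [|x y xZ yZ]; [exact: rpred0 | exact: rpredB]. Qed.

HB.instance Definition _ :=
  GRing.isZmodClosed.Build Zinv integral integral_zmod_closed.

Definition prufer := Quotient.quot integral.
HB.instance Definition _ := GRing.Zmodule.on prufer.

Lemma frac_subproof (z : int) (n : nat) : z%:~R / p%:R ^+ n \in Zinv_pred.
Proof. by apply/asboolP; exists z, n. Qed.

Definition frac (z : int) (n : nat) : Zinv := MkZinv (frac_subproof z n).

(** Through [Cantor.of_nat] and [decode_int], n encodes a numerator and the
  exponent of a denominator; the group operation is computable on these
  codes. *)
Definition Zinv_element (n : nat) : Zinv :=
  let: (i, j) := Cantor.of_nat n in frac (decode_int i) j.

Lemma Zinv_element_onto x : exists n, Zinv_element n = x.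
Proof.
case: x => x xZ; have /asboolP[z [n xE]] := xZ.
exists (Cantor.to_nat (code_int z, n)).
by rewrite /Zinv_element Cantor.cancel_of_to code_intK; apply: val_inj.
Qed.

Definition Zinv_numbering : numbering Zinv := Numbering Zinv_element_onto.

Definition prufer_element (n : nat) : prufer :=
  \pi_(Quotient.quot integral)%qT (Zinv_element n).

Lemma prufer_element_onto x : exists n, prufer_element n = x.
Proof.
have [n nE] := Zinv_element_onto (repr x).
by exists n; rewrite /prufer_element nE reprK.
Qed.

Definition prufer_numbering : numbering prufer := Numbering prufer_element_onto.

End InvertP.

(** A p-adic integer is the coherent sequence of its residues modulo p^n, each
  residue being taken in the interval [0, p^n). *)

Section Padic.
Variable p : nat.
Local Notation q n := (p%:Z ^+ n).

Definition coherent : {pred nat -> int} := fun x =>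
  `[< forall n, x n = (x n.+1 %% q n)%Z >].

Record padic := Padic { residue :> nat -> int; _ : residue \in coherent }.
HB.instance Definition _ := [isSub for residue].
HB.instance Definition _ := [Choice of padic by <:].

Lemma coherentP (x : padic) n : x n = (x n.+1 %% q n)%Z.
Proof. by case: x => x /= /asboolP. Qed.

Lemma modz_pow_succ (z : int) n : ((z %% q n.+1)%Z %% q n)%Z = (z %% q n)%Z.
Proof.
rewrite [in RHS](intdiv.divz_eq z (q n.+1)) exprS mulrA.
by rewrite modzMDl.
Qed.

Lemma residue_mod (x : padic) n : (x n %% q n)%Z = x n.
Proof. by rewrite coherentP modz_mod. Qed.

Lemma padic_of_int_subproof (z : int) : (fun n => (z %% q n)%Z) \in coherent.
Proof. by apply/asboolP => n; rewrite modz_pow_succ. Qed.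

Definition padic_of_int (z : int) : padic := Padic (padic_of_int_subproof z).

Lemma padic_add_subproof (x y : padic) :
  (fun n => ((x n + y n) %% q n)%Z) \in coherent.
Proof.
apply/asboolP => n; rewrite modz_pow_succ.
by rewrite [x n]coherentP [y n]coherentP modzDm.
Qed.

Lemma padic_opp_subproof (x : padic) :
  (fun n => ((- x n) %% q n)%Z) \in coherent.
Proof.
by apply/asboolP => n; rewrite modz_pow_succ [x n]coherentP modzNm.
Qed.

Definition padic_add (x y : padic) : padic := Padic (padic_add_subproof x y).
Definition padic_opp (x : padic) : padic := Padic (padic_opp_subproof x).

Lemma padic_addA : associative padic_add.
Proof.
by move=> x y z; apply/val_inj/funext=> n /=; rewrite modzDml modzDmr addrA.
Qed.

Lemma padic_addC : commutative padic_add.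
Proof. by move=> x y; apply/val_inj/funext=> n /=; rewrite addrC. Qed.

Lemma padic_add0 : left_id (padic_of_int 0) padic_add.
Proof.
by move=> x; apply/val_inj/funext=> n /=; rewrite mod0z add0r residue_mod.
Qed.

Lemma padic_addN : left_inverse (padic_of_int 0) padic_opp padic_add.
Proof.
by move=> x; apply/val_inj/funext=> n /=; rewrite modzDml addNr.
Qed.

HB.instance Definition _ :=
  GRing.isZmodule.Build padic padic_addA padic_addC padic_add0 padic_addN.

Definition padic_int : {pred padic} := fun x =>
  `[< exists z : int, x = padic_of_int z >].

Lemma padic_int_zmod_closed : zmod_closed padic_int.
Proof.
split; first by apply/asboolP; exists 0.
move=> _ _ /asboolP[z ->] /asboolP[w ->]; apply/asboolP; exists (z - w).
by apply/val_inj/funext=> n /=; rewrite modzNm modzDm.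
Qed.

HB.instance Definition _ :=
  GRing.isZmodClosed.Build padic padic_int padic_int_zmod_closed.

Definition padic_mod_int := Quotient.quot padic_int.
HB.instance Definition _ := GRing.Zmodule.on padic_mod_int.

(** The residues modulo p^n are eventually equal, for each n: this is
  convergence in the p-adic topology. *)
Definition padic_cvg (u : nat -> padic) (x : padic) : Prop :=
  forall n, exists N, forall m, (N <= m)%N -> u m n = x n.

Definition padic_names (a : nat -> int) (x : padic) : Prop :=
  padic_cvg (fun m => padic_of_int (\sum_(i < m) a i * q i)) x.

Lemma padic_names_fun a x y : padic_names a x -> padic_names a y -> x = y.
Proof.
move=> ax ay; apply/val_inj/funext=> n.
have [N xN] := ax n; have [N' yN'] := ay n.
by rewrite /= -(xN (maxn N N')) ?leq_maxl // yN' ?leq_maxr.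
Qed.

Lemma padic_names_onto x : exists a, padic_names a x.
Proof.
exists (fun i => (x i.+1 %/ q i)%Z) => n; exists n => m le_nm /=.
have -> : \sum_(i < m) (x i.+1 %/ q i)%Z * q i = x m.
  elim: m {le_nm} => [|m IHm].
    by rewrite big_ord0 coherentP expr0 modz1.
  by rewrite big_ord_recr /= IHm [in LHS](coherentP x m) addrC -intdiv.divz_eq.
rewrite -(subnK le_nm); elim: (m - n)%N => [|k IHk].
  by rewrite add0n residue_mod.
rewrite addSn -IHk [x (k + n)%N]coherentP.
rewrite [in LHS](intdiv.divz_eq (x (k + n).+1) (q (k + n))) exprD mulrA.
by rewrite modzMDl.
Qed.

Definition padic_representation : representation padic :=
  Representation int_coding padic_names_fun padic_names_onto.

Definition padic_mod_int_names (a : nat -> int) (y : padic_mod_int) : Prop :=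
  exists2 x, \pi_(Quotient.quot padic_int)%qT x = y & padic_names a x.

Lemma padic_mod_int_names_fun a x y :
  padic_mod_int_names a x -> padic_mod_int_names a y -> x = y.
Proof. by move=> [x' <- ax] [y' <- ay]; rewrite (padic_names_fun ax ay). Qed.

Lemma padic_mod_int_names_onto y : exists a, padic_mod_int_names a y.
Proof.
have [a ax] := padic_names_onto (repr y).
by exists a, (repr y) => //; rewrite reprK.
Qed.

Definition padic_mod_int_representation : representation padic_mod_int :=
  Representation int_coding padic_mod_int_names_fun padic_mod_int_names_onto.

End Padic.

(* Main.v *)
From HB Require Import structures.
From Stdlib Require Cantor.
From Stdlib Require Import Relation_Operators.
From mathcomp Require Import all_boot all_order all_algebra.
From mathcomp Require Import ring_quotient boolp zify ring.
Require Import Defs.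

Set Implicit Arguments.
Unset Strict Implicit.
Unset Printing Implicit Defensive.

Import Order.TTheory GRing.Theory Num.Theory.

(** Let q be the projection of Z[1/p] onto C, where C is Z(p^oo) or Z[1/p]
  itself, and let t_n be the image of 1/p^n. In the extension of C by Z that a
  cocycle f defines, the lifts e_n = (0, t_n) satisfy p e_(n+1) = e_n + d_n
  with the integer d_n = f(t_(n+1), 0) + ... + f(t_(n+1), (p-1) t_(n+1)), which
  is [digit]. The invariant of f is the p-adic integer sum_n d_n p^n, which is
  [series]. The extension splits when the lifts can be corrected by integers
  c_n with p c_(n+1) = c_n + d_n. This happens exactly when the series is an
  integer z, and then c_n is the n-th partial sum minus z, divided by p^n. Over
  Z(p^oo) the lift of t_0 = 0 has to be 0 as well, which forces z = 0
  ([series_coboundary], [coboundary_series]). So the series embeds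
  Ext(Z[1/p], Z) into Z_p/Z and Ext(Z(p^oo), Z) into Z_p. It is onto: given x,
  let phi(z/p^n) be the fractional part of x z/p^n. The coboundary of phi is an
  integral cocycle [carry x], and its digits telescope to x ([carry_series]).

  Both directions are computable, by the same two machines for both groups. The
  sequence d_n is itself a name of the series, and d_n needs p values of f. The
  value of [carry x] at two fractions with denominators p^k and p^l is the
  carry that arises when two residues modulo p^(k+l) are added, and it needs
  the first k+l letters of a name of x. Over Z[1/p] the input is a name of any
  representative x of a class modulo Z, which is harmless because the class of
  [carry x] is determined by its series ([padic_Ext_isomorphic]).

  The machines come from terms for primitive recursive functions with oracle
  calls. A term is compiled to commands on registers, these to a list of
  instructions with jumps, and the list is run by a machine that has one tape
  for each register ([machine_of_term]). *)

(** * Register programs on Turing machines *)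

Definition upd (A : Type) (s : nat -> A) (r : nat) (x : A) : nat -> A :=
  fun i => if i == r then x else s i.

Lemma upd_fun A B (h : A -> B) s r x : h \o upd s r x = upd (h \o s) r (h x).
Proof. by apply/funext => i; rewrite /upd /=; case: ifP. Qed.

Lemma upd_at A (s : nat -> A) r x : upd s r x r = x.
Proof. by rewrite /upd eqxx. Qed.

Lemma upd_upd A (s : nat -> A) r x y : upd (upd s r x) r y = upd s r y.
Proof. by apply/funext => i; rewrite /upd; case: eqP. Qed.

(** Register 0 serves the oracle: [Ask] replaces its content n by the value of
  the oracle at n. *)
Inductive cmd :=
  | Skip
  | Inc of nat
  | Dec of nat
  | Ask
  | Seq of cmd & cmd
  | While of nat & cmd.

Inductive exec (o : nat -> nat) : cmd -> (nat -> nat) -> (nat -> nat) -> Prop :=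
  | exec_skip s : exec o Skip s s
  | exec_inc r s : exec o (Inc r) s (upd s r (s r).+1)
  | exec_dec r s : exec o (Dec r) s (upd s r (s r).-1)
  | exec_ask s : exec o Ask s (upd s 0 (o (s 0)))
  | exec_seq c1 c2 s t u :
      exec o c1 s t -> exec o c2 t u -> exec o (Seq c1 c2) s u
  | exec_stop r c s : s r = 0 -> exec o (While r c) s s
  | exec_loop r c s t u : s r != 0 -> exec o c s t ->
      exec o (While r c) t u -> exec o (While r c) s u.

(** [Branch r l1 l2] jumps to l1 if register r is nonzero, else to l2. An
  increment takes two instructions because a transition writes before it moves:
  [Back] scans the cell to the left of the block and [Mark] fills it. As the
  default value of [nth], [Stop] is what follows the end of a program. *)
Inductive instr :=
  | Back of nat
  | Mark of nat
  | Drop of nat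
  | Query
  | Branch of nat & nat & nat
  | Stop.

Fixpoint assemble (i : nat) (c : cmd) : seq instr :=
  match c with
  | Skip => [::]
  | Inc r => [:: Back r; Mark r]
  | Dec r => [:: Drop r]
  | Ask => [:: Query]
  | Seq c1 c2 => let p1 := assemble i c1 in p1 ++ assemble (i + size p1) c2
  | While r c1 =>
      let p1 := assemble i.+1 c1 in
      Branch r i.+1 (i + size p1).+2 :: rcons p1 (Branch r i i)
  end.

Definition register (x : instr) : nat :=
  match x with
  | Back r | Mark r | Drop r | Branch r _ _ => r
  | _ => 0
  end.

(** A machine has a single answer state, so the place where a program continues
  after a query cannot be stored in the state. It is stored on the tape [None],
  whose scanned letter is the label of the current instruction. A letter is thus
  [Some] label or the mark [None]. Label 0 is also the blank: on a blank tape
  the program starts at its first instruction. The states [None], [Some true]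
  and [Some false] are the running, the query and the halting state; the running
  state is also the start and the answer state. *)
Section Machine.
Variables (P : seq instr) (R : nat).

Let label := 'I_(size P).+1.
Let sym := option label.
Let tp := option 'I_R.+1.

Definition focus (r : nat) : tp := Some (inord r).

Definition act (l : nat) (a : tp -> sym * direction) :
    {ffun tp -> sym * direction} :=
  [ffun i => if i is Some _ then a i else (Some (inord l), Stay)].

Definition keep (scanned : {ffun tp -> sym}) (i : tp) := (scanned i, Stay).

Definition control (q : option bool) (scanned : {ffun tp -> sym}) :
    option bool * {ffun tp -> sym * direction} :=
  let l : nat := if scanned None is Some l then l else 0 in
  let on r a := act l.+1 (fun i => if i == focus r then a i
                                           else keep scanned i) in
  match nth Stop P l with
  | Back r => (None, on r (fun i => (scanned i, Left)))
  | Mark r => (None, on r (fun i => (None, Stay)))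
  | Drop r => (None, on r (fun i => (Some ord0, Right)))
  | Query => (Some true, act l.+1 (keep scanned))
  | Branch r l1 l2 =>
      (None, act (if scanned (focus r) == None then l1 else l2)
               (keep scanned))
  | Stop => (Some false, act l (keep scanned))
  end.

Definition compiled : machine :=
  @Machine (option bool) sym tp (Some ord0) None isT None (Some true) None
    (Some false) (focus 1) (focus 0) (focus 2) control.

Variable o : nat -> nat.
Implicit Type T : nat -> contents compiled.

Definition tapes (l : nat) T : tape compiled -> contents compiled :=
  fun i => if i is Some r then T (r : 'I_R.+1)
           else fun z => if z == 0%R then Some (inord l) else Some ord0.

Definition reaches := clos_refl_trans_1n _ (@step compiled o).

Lemma reaches_trans x y z : reaches x y -> reaches y z -> reaches x z.
Proof. by elim=> // a b c ab _ IH /IH; apply: rt1n_trans ab. Qed.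

Lemma reaches_step x y : step o x y -> reaches x y.
Proof. by move=> xy; apply: rt1n_trans xy _; apply: rt1n_refl. Qed.

Lemma write_keep (t : contents compiled) : write_move t (t 0%R, Stay) = t.
Proof. by apply/funext => z; rewrite /write_move /=; case: eqP => [->|]. Qed.

Lemma write_label l l' T :
  write_move (tapes l T None) (Some (inord l'), Stay) = tapes l' T None.
Proof. by apply/funext => z; rewrite /write_move /=; case: eqP. Qed.

Lemma focus_eq (r : nat) (i : 'I_R.+1) : (r <= R)%N ->
  (Some i == focus r) = (i == r :> nat).
Proof.
by move=> rR; rewrite /focus; apply/eqP/eqP => [[->]|<-];
  rewrite ?inordK ?inord_val.
Qed.

Definition at_label (l : nat) (s : nat -> nat) : config compiled :=
  (None, tapes l (@block compiled \o s)).

Definition scan l T : {ffun tp -> sym} := [ffun i => tapes l T i 0%R].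

Lemma step_at l T : step o (None : state compiled, tapes l T)
   (let r := control None (scan l T) in
    (r.1 : state compiled, fun i => write_move (tapes l T i) (r.2 i))).
Proof. exact: (@step_transition compiled). Qed.

Lemma act_keep l T l' :
  (fun i => write_move (tapes l T i) (act l' (keep (scan l T)) i))
  = tapes l' T.
Proof.
apply/funext => -[i|]; last by rewrite /act ffunE write_label.
by rewrite /act ffunE /keep /scan ffunE write_keep.
Qed.

Lemma act_on l T l' r a : (r <= R)%N ->
  (fun i => write_move (tapes l T i)
     (act l' (fun i => if i == focus r then a i
                                  else keep (scan l T) i) i))
  = tapes l' (upd T r (write_move (T r) (a (focus r)))).
Proof.
move=> rR; apply/funext => -[i|]; last by rewrite /act ffunE write_label.
rewrite /act ffunE focus_eq // /= /upd; case: eqP => [ir|_].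
  have -> : Some i = focus r by apply/eqP; rewrite focus_eq // ir.
  by rewrite ir.
by rewrite /keep /scan ffunE write_keep.
Qed.

Hypothesis bounded : forall l, (register (nth Stop P l) <= R)%N.

(** A configuration is described by the contents T of the register tapes, which
  need not be blocks: between [Back] and [Mark] one of them is not. *)
Definition effect (x : instr) (l : nat) T : config compiled :=
  match x with
  | Back r =>
      (None, tapes l.+1 (upd T r (write_move (T r) (T r 0%R, Left))))
  | Mark r =>
      (None, tapes l.+1 (upd T r
        (write_move (T r) (None : symbol compiled, Stay))))
  | Drop r =>
      (None, tapes l.+1 (upd T r
        (write_move (T r) (Some ord0 : symbol compiled, Right))))
  | Query => (Some true, tapes l.+1 T)
  | Branch r l1 l2 =>
      (None, tapes (if T r 0%R == None :> symbol compiled then l1 else l2) T)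
  | Stop => (Some false, tapes l T)
  end.

Lemma run_instr l T x : (l <= size P)%N -> nth Stop P l = x ->
  reaches (None, tapes l T) (effect x l T).
Proof.
move=> lP xE; have := bounded l; have := step_at l T; rewrite /control.
have -> : (if scan l T None is Some l' then l' : nat else 0%N) = l.
  by rewrite ffunE /= inordK.
have sc r : (r <= R)%N -> scan l T (focus r) = T r 0%R.
  by move=> rR; rewrite ffunE /= inordK.
rewrite xE; case: x xE => [r|r|r||r l1 l2|] /= _ + rR => /reaches_step;
  rewrite ?act_keep ?act_on //= ?sc //.
Qed.

Lemma block_scan n : (@block compiled n 0%R == None) = (n != 0%N).
Proof. by rewrite /block /=; case: n. Qed.

Lemma block_inc n :
  write_move (write_move (@block compiled n) (@block compiled n 0%R, Left))
    (None : symbol compiled, Stay) = @block compiled n.+1.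
Proof.
apply/funext => z; rewrite /write_move /block /=.
case: eqP => [->|z0] //; case: eqP => [z1|z1].
  have -> : z = 1%R by lia.
  by case: n.
by congr (if _ then _ else _); lia.
Qed.

Lemma block_dec n :
  write_move (@block compiled n) (Some ord0 : symbol compiled, Right)
  = @block compiled n.-1.
Proof.
apply/funext => z; rewrite /write_move /block /=; case: eqP => [z0|z0].
  by have -> : z = (-1)%R by lia.
by congr (if _ then _ else _); lia.
Qed.

Lemma run_at l x r T : P = l ++ x :: r ->
  reaches (None, tapes (size l) T) (effect x (size l) T).
Proof.
move=> PE; apply: run_instr; first by rewrite PE size_cat leq_addr.
by rewrite PE nth_cat ltnn subnn.
Qed.

Lemma reads_block n : reads (@block compiled n) n.
Proof.
split=> [i lt_in|]; rewrite /block; last by rewrite ltxx andbF.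
by case: ifP => //; lia.
Qed.

(** The position of the code of c in P is arbitrary because its jumps are
  absolute. *)
Lemma reaches_assemble c s t : exec o c s t -> forall l r,
  P = l ++ assemble (size l) c ++ r ->
  reaches (at_label (size l) s) (at_label (size l + size (assemble (size l) c)) t).
Proof.
elim=> {c s t} /=.
- by move=> s l r PE; rewrite addn0; apply: rt1n_refl.
- move=> r s l rest PE; rewrite addn2.
  have := run_at (@block compiled \o s) PE => /reaches_trans; apply.
  rewrite /=; set T := upd _ _ _; rewrite /= -cat_rcons in PE.
  have := run_at T PE; rewrite /= size_rcons {}/T upd_at upd_upd /= block_inc.
  by rewrite /at_label upd_fun.
- move=> r s l rest PE; rewrite addn1.
  have := run_at (@block compiled \o s) PE.
  by rewrite /= block_dec /at_label upd_fun.
- move=> s l rest PE; rewrite addn1.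
  have := run_at (@block compiled \o s) PE => /reaches_trans; apply.
  apply/reaches_step; rewrite /at_label upd_fun.
  have q : query compiled != halt compiled by [].
  have := @step_query compiled o (tapes (size l).+1 (@block compiled \o s)) (s 0) q.
  have -> : tapes (size l).+1 (@block compiled \o s) (oracle_tape compiled)
            = @block compiled (s 0) by rewrite /= inordK.
  move=> /(_ (reads_block _)); congr step; congr (_, _).
  by apply/funext => -[i|] //=; rewrite focus_eq // /upd /=; case: eqP.
- move=> c1 c2 s t u _ IH1 _ IH2 l r PE.
  rewrite -catA in PE.
  apply: reaches_trans (IH1 _ _ PE) _.
  rewrite catA -size_cat in PE; have := IH2 _ _ PE.
  by rewrite !size_cat addnA.
- move=> r c s sr l rest PE.
  have := run_at (@block compiled \o s) PE.
  by rewrite /= block_scan sr /= size_rcons -!addnS.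
- move=> r c s t u sr _ IH1 _ IH2 l rest PE.
  apply: reaches_trans (IH2 _ _ PE).
  have := run_at (@block compiled \o s) PE.
  rewrite /= block_scan sr => /reaches_trans; apply.
  rewrite /= in PE; set b := Branch r _.+1 _ in PE.
  have P1 : P = rcons l b ++ assemble (size (rcons l b)) c ++
                Branch r (size l) (size l) :: rest.
    by rewrite size_rcons cat_rcons PE /= -(cat_rcons _ (assemble _ c)).
  have := IH1 _ _ P1; rewrite size_rcons => /reaches_trans; apply.
  rewrite catA in P1; have := run_at (@block compiled \o t) P1.
  by rewrite /= size_cat size_rcons if_same addSnnS.
Qed.
End Machine.

(** There is a tape for each register up to the largest one of the code, so that
  [inord] keeps registers apart; the bound 2 provides the input tape 1 and the
  output tape 2. *)
Definition program (c : cmd) : machine :=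
  compiled (assemble 0 c) (maxn 2 (\max_(x <- assemble 0 c) register x)).

Lemma program_outputs o c n t :
  exec o c (nth 0 [:: 0; n]) t -> outputs (program c) o n (t 2).
Proof.
rewrite /program; set R := maxn 2 _; move=> ct.
have bounded l : register (nth Stop (assemble 0 c) l) <= R.
  rewrite leq_max; apply/orP; right.
  have [lP|Pl] := ltnP l (size (assemble 0 c)); last by rewrite nth_default.
  by rewrite (big_nth Stop) big_mkord (leq_bigmax (Ordinal lP)).
have R2 : 2 <= R by rewrite leq_maxl.
have /= := reaches_assemble bounded ct (l := [::]) (r := [::]).
rewrite cats0 => /(_ erefl) run.
exists (@tapes (assemble 0 c) R (size (assemble 0 c))
          (@block (compiled (assemble 0 c) R) \o t)).
  (* The label after the last instruction is in range and reads [Stop]. *)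
  have := run_instr o bounded (@block (compiled (assemble 0 c) R) \o t) (leqnn _).
  rewrite nth_default // => /(_ _ erefl) stop.
  have -> : initial (compiled (assemble 0 c) R) n
          = @at_label (assemble 0 c) R 0 (nth 0 [:: 0; n]).
    congr (_, _); apply/funext => -[i|] /=.
      rewrite focus_eq ?(leq_trans _ R2) //.
      by case: (i : nat) => [|[|k]]; rewrite //= nth_nil.
    apply/funext => z; rewrite /block; case: ifP => z0; first by lia.
    case: ifP => _ //; congr Some; apply/val_inj.
    by rewrite /= inordK.
  exact: reaches_trans run stop.
by rewrite /= inordK //; apply: reads_block.
Qed.

(** * Terms for primitive recursive functions with an oracle *)

(** Registers are used as a stack: v lists the contents of registers 1, 2, and so
  on, and register 0 and the registers beyond v are zero. *)
Definition store (v : seq nat) : nat -> nat := nth 0 (0 :: v).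

Lemma store_rcons v n : store (rcons v n) = upd (store v) (size v).+1 n.
Proof.
apply/funext => i; rewrite /store /upd -rcons_cons nth_rcons /=.
by case: ltngtP => // vi; rewrite nth_default //= ltnW.
Qed.

Lemma store_default v r : size v < r -> store v r = 0.
Proof. by move=> vr; rewrite /store nth_default. Qed.

Definition move a b := While a (Seq (Dec a) (Inc b)).
Definition clear a := While a (Dec a).

Section Exec.
Variable o : nat -> nat.

Lemma exec_eq c s t t' : exec o c s t -> t =1 t' -> exec o c s t'.
Proof. by move=> ct /funext <-. Qed.

Lemma exec_move a b s : a != b ->
  exec o (move a b) s (upd (upd s b (s b + s a)) a 0).
Proof.
move=> ab; move En: (s a) => n; elim: n s En => [|n IHn] s sa.
  apply: exec_eq (exec_stop _ _ sa) _ => i; rewrite /upd.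
  by do 2!case: eqP => [->|_] //; lia.
apply: exec_loop; first by rewrite sa.
  by apply: exec_seq; [apply: exec_dec | apply: exec_inc].
apply: exec_eq (IHn _ _) _ => [|i]; rewrite /upd; first by do !case: eqP => /=; lia.
by do !case: eqP => /=; lia.
Qed.

Lemma exec_clear a s : exec o (clear a) s (upd s a 0).
Proof.
move En: (s a) => n; elim: n s En => [|n IHn] s sa.
  by apply: exec_eq (exec_stop _ _ sa) _ => i; rewrite /upd; case: eqP => [->|].
apply: exec_loop; first by rewrite sa.
  exact: exec_dec.
by rewrite -[X in exec _ _ _ X](upd_upd s a (s a).-1); apply: IHn; rewrite upd_at sa.
Qed.

Definition settle d := Seq (clear d) (move d.+1 d).

Lemma exec_settle v a b :
  exec o (settle (size v).+1) (store (rcons (rcons v a) b)) (store (rcons v b)).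
Proof.
apply: exec_seq (exec_clear _ _) _; apply: exec_eq (exec_move _ _) _; first by lia.
move=> i; rewrite !store_rcons !size_rcons /upd; do !case: eqP => /=; try lia.
by move=> *; rewrite store_default; lia.
Qed.
End Exec.

(** A term is compiled for a given first free register, in which it leaves its
  value. Variables are registers, so that functions on [nat] serve as
  binders. *)
Definition term := nat -> cmd.

(** The quantification over the extensions w of v is needed because the stack has
  grown when a subterm of a compound term is evaluated. *)
Definition evals o (v : seq nat) (e : term) (n : nat) : Prop :=
  forall w, prefix v w -> exec o (e (size w).+1) (store w) (store (rcons w n)).

Definition holds (v : seq nat) (x n : nat) : Prop :=
  0 < x <= size v /\ store v x = n.

Definition Const c : term := fun d => iter c (Seq^~ (Inc d)) Skip.
Definition Var x : term := fun d =>
  Seq (While x (Seq (Dec x) (Seq (Inc d) (Inc d.+1)))) (move d.+1 x).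
Definition Succ (e : term) : term := fun d => Seq (e d) (Inc d).
Definition Pred (e : term) : term := fun d => Seq (e d) (Dec d).
Definition Oracle (e : term) : term := fun d =>
  Seq (e d) (Seq (move d 0) (Seq Ask (move 0 d))).
(** The registers x and y of [es x y] hold the loop counter, which runs down from
  the value of e, and the accumulator, which starts as the value of e0. *)
Definition Rec (e e0 : term) (es : nat -> nat -> term) : term := fun d =>
  Seq (e d) (Seq (e0 d.+1)
    (Seq (While d (Seq (Dec d) (Seq (es d d.+1 d.+2) (settle d.+1)))) (settle d))).

(** This is f 0 (f 1 (... (f (n-1) a))). *)
Fixpoint countdown (n : nat) (f : nat -> nat -> nat) (a : nat) : nat :=
  if n is m.+1 then countdown m f (f m a) else a.

Section Evals.
Variable o : nat -> nat.

Lemma evals_weaken v w e n : prefix v w -> evals o v e n -> evals o w e n.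
Proof. by move=> vw en x wx; apply: en (prefix_trans vw wx). Qed.

Lemma holds_weaken v w x n : prefix v w -> holds v x n -> holds w x n.
Proof.
move=> /prefixP[u ->] [xv <-]; split; first by rewrite size_cat; lia.
by rewrite /store -cat_cons nth_cat /=; case: ltnP => //; lia.
Qed.

Lemma holds_last v n : holds (rcons v n) (size v).+1 n.
Proof. by rewrite /holds size_rcons store_rcons upd_at leqnn. Qed.

Lemma evals_const v c : evals o v (Const c) c.
Proof.
move=> w _; elim: c => [|c IHc] /=.
  apply: exec_eq (exec_skip _ _) _ => i; rewrite store_rcons /upd.
  by case: eqP => // ->; rewrite store_default.
apply: exec_seq IHc _; apply: exec_eq (exec_inc _ _ _) _ => i.
by rewrite !store_rcons upd_at upd_upd.
Qed.

Lemma evals_succ v e n : evals o v e n -> evals o v (Succ e) n.+1.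
Proof.
move=> en w /en en'; apply: exec_seq en' _.
apply: exec_eq (exec_inc _ _ _) _ => i.
by rewrite !store_rcons upd_at upd_upd.
Qed.

Lemma evals_pred v e n : evals o v e n -> evals o v (Pred e) n.-1.
Proof.
move=> en w /en en'; apply: exec_seq en' _.
apply: exec_eq (exec_dec _ _ _) _ => i.
by rewrite !store_rcons upd_at upd_upd.
Qed.

(** Moving the content of a register destroys it; it is moved to two registers at
  once and restored from the second one. *)
Lemma evals_var v x n : holds v x n -> evals o v (Var x) n.
Proof.
move=> xn w vw; have [/andP[x0 xw] sx] := holds_weaken vw xn.
set d := (size w).+1; have d0 : store w d = 0 by rewrite store_default.
have d1 : store w d.+1 = 0 by rewrite store_default // /d.
have xd : x < d by []; rewrite store_rcons -/d; move: d d0 d1 xd => d d0 d1 xd.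
have loop m s : s x = m -> exec o (While x (Seq (Dec x) (Seq (Inc d) (Inc d.+1)))) s
    (upd (upd (upd s d.+1 (s d.+1 + m)) d (s d + m)) x 0).
  elim: m s => [|m IHm] s sm.
    apply: exec_eq (exec_stop _ _ sm) _ => i; rewrite /upd.
    by do !case: eqP => [->|] //=; lia.
  apply: exec_loop; first by rewrite sm.
    by apply: exec_seq (exec_dec _ _ _) (exec_seq (exec_inc _ _ _) (exec_inc _ _ _)).
  apply: exec_eq (IHm _ _) _ => [|i]; rewrite /upd; do !case: eqP => * //=; subst; lia.
apply: exec_seq (loop n _ sx) _; apply: exec_eq (exec_move _ _ _) _ => [|i].
  by lia.
by rewrite /upd; do !case: eqP => * //=; subst; lia.
Qed.

Lemma evals_oracle v e n : evals o v e n -> evals o v (Oracle e) (o n).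
Proof.
move=> en w /en en'; apply: exec_seq en' _.
apply: exec_seq (exec_move _ _ _) _ => //.
apply: exec_seq (exec_ask _ _) _.
apply: exec_eq (exec_move _ _ _) _ => // i.
rewrite !store_rcons /upd; do !case: eqP => //= *; try lia; subst => //.
Qed.

(** Between two rounds the stack w is extended by the counter and the accumulator;
  the new value of the accumulator appears on top of them and [settle] moves it
  to its place. *)
Lemma evals_rec v e n e0 a es f :
  evals o v e n -> evals o v e0 a ->
  (forall w x y k b, prefix v w -> holds w x k -> holds w y b ->
     evals o w (es x y) (f k b)) ->
  evals o v (Rec e e0 es) (countdown n f a).
Proof.
move=> en ea ef w vw; apply: exec_seq (en _ vw) _.
have pre b : prefix w (rcons w b) by apply: prefix_rcons.
have := ea _ (prefix_trans vw (pre n)); rewrite size_rcons => /exec_seq; apply.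
apply: exec_seq (exec_settle _ _ 0 _); rewrite -/(settle _).
elim: n {en} a {ea} => [|n IHn] a /=.
  apply: exec_stop; rewrite !store_rcons /upd size_rcons.
  by rewrite eqxx; case: eqP => //; lia.
apply: exec_loop (IHn _).
  rewrite !store_rcons /upd size_rcons eqxx.
  by rewrite (ltn_eqF (ltnSn _)).
apply: exec_seq.
  apply: exec_dec.
set s := upd _ _ _; have {s}-> : s = store (rcons (rcons w n) a).
  apply/funext => i; rewrite /s !store_rcons /upd !size_rcons.
  by do !case: eqP => //=; lia.
have b2 := holds_last (rcons w n) a.
have b1 := holds_weaken (prefix_rcons (rcons w n) a) (holds_last w n).
rewrite size_rcons in b2.
have pre2 := prefix_trans (pre n) (prefix_rcons (rcons w n) a).
have := ef _ _ _ _ _ (prefix_trans vw pre2) b1 b2 _ (prefix_refl _).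
rewrite !size_rcons => /exec_seq; apply.
by have := exec_settle o (rcons w n) a (f n a); rewrite size_rcons.
Qed.
End Evals.

(** * Arithmetic terms and the Cantor pairing *)

Definition Add e1 e2 := Rec e2 e1 (fun _ y => Succ (Var y)).
Definition Minus e1 e2 := Rec e2 e1 (fun _ y => Pred (Var y)).
Definition Mul e1 e2 := Rec e2 (Const 0) (fun _ y => Add (Var y) e1).
Definition Pow e1 e2 := Rec e2 (Const 1) (fun _ y => Mul (Var y) e1).
Definition Sum e (f : nat -> term) := Rec e (Const 0) (fun x y => Add (Var y) (f x)).
Definition IsZero e := Minus (Const 1) e.
Definition Le e1 e2 := IsZero (Minus e1 e2).
Definition Eqn e1 e2 := Mul (Le e1 e2) (Le e2 e1).
Definition Parity e := Rec e (Const 0) (fun _ y => IsZero (Var y)).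
Definition Half e := Sum e (fun x => Parity (Var x)).
(** Counts up to e1, starting again from 0 whenever e2 is reached. *)
Definition Mod e1 e2 :=
  Rec e1 (Const 0) (fun _ y => Mul (Succ (Var y)) (IsZero (Eqn (Succ (Var y)) e2))).
Definition Pair e1 e2 := Add e2 (Sum (Add e2 e1) (fun x => Succ (Var x))).
(** A pair and both of its components are bounded by its Cantor number, so the
  components are found by a bounded search, written as a double sum with at most
  one nonzero term. *)
Definition Fst e := Sum (Succ e) (fun x => Sum (Succ e) (fun y =>
  Mul (Var x) (Eqn (Pair (Var x) (Var y)) e))).
Definition Snd e := Sum (Succ e) (fun x => Sum (Succ e) (fun y =>
  Mul (Var y) (Eqn (Pair (Var x) (Var y)) e))).

(** Carries the hypotheses on a stack over to the extension given by vw. *)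
Ltac extend vw :=
  repeat match type of vw with is_true (prefix ?v _) =>
    match goal with
    | H : evals _ v _ _ |- _ => apply (evals_weaken vw) in H
    | H : holds v _ _ |- _ => apply (holds_weaken vw) in H
    end
  end.

Section Arithmetic.
Variable o : nat -> nat.
Local Notation "v ⊢ e ⇓ n" := (evals o v e n)
  (at level 70, e at next level, n at next level).

Lemma evals_add v e1 e2 a b : v ⊢ e1 ⇓ a -> v ⊢ e2 ⇓ b ->
  v ⊢ Add e1 e2 ⇓ a + b.
Proof.
move=> ea eb; have -> : a + b = countdown b (fun _ c => c.+1) a.
  by elim: b a {ea eb} => [|b IHb] a /=; rewrite ?addn0 // -IHb addSnnS.
by apply: evals_rec => // w x y k c _ _ yc; apply/evals_succ/evals_var.
Qed.

Lemma evals_minus v e1 e2 a b : v ⊢ e1 ⇓ a -> v ⊢ e2 ⇓ b ->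
  v ⊢ Minus e1 e2 ⇓ a - b.
Proof.
move=> ea eb; have -> : a - b = countdown b (fun _ c => c.-1) a.
  by elim: b a {ea eb} => [|b IHb] a /=; rewrite ?subn0 // -IHb; lia.
by apply: evals_rec => // w x y k c _ _ yc; apply/evals_pred/evals_var.
Qed.

Lemma evals_is_zero v e n : v ⊢ e ⇓ n -> v ⊢ IsZero e ⇓ (n == 0).
Proof.
move=> en; have -> : (n == 0 : nat) = 1 - n by case: n en => [|[]].
by apply: evals_minus => //; apply: evals_const.
Qed.

Lemma evals_le v e1 e2 a b : v ⊢ e1 ⇓ a -> v ⊢ e2 ⇓ b ->
  v ⊢ Le e1 e2 ⇓ (a <= b).
Proof. by move=> ea eb; apply/evals_is_zero/evals_minus. Qed.
Lemma evals_sum v e n es f : v ⊢ e ⇓ n ->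
  (forall w x k, prefix v w -> holds w x k -> evals o w (es x) (f k)) ->
  v ⊢ Sum e es ⇓ \sum_(0 <= k < n) f k.
Proof.
move=> en ef; have -> : \sum_(0 <= k < n) f k = countdown n (fun k c => c + f k) 0.
  suff IH a : a + \sum_(0 <= k < n) f k = countdown n (fun k c => c + f k) a.
    by rewrite -IH.
  elim: n a {en} => [|n IHn] a /=; first by rewrite big_geq ?addn0.
  by rewrite big_nat_recr //= -IHn; lia.
apply: evals_rec => // [|w x y k c vw xk yc]; first exact: evals_const.
by apply: evals_add; [apply: evals_var | apply: ef].
Qed.

Lemma evals_mul v e1 e2 a b : v ⊢ e1 ⇓ a -> v ⊢ e2 ⇓ b ->
  v ⊢ Mul e1 e2 ⇓ a * b.
Proof.
move=> ea eb; have -> : a * b = countdown b (fun _ c => c + a) 0.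
  suff IH c : c + a * b = countdown b (fun _ c => c + a) c by rewrite -IH.
  by elim: b c {eb} => [|b IHb] c /=; rewrite -?IHb; lia.
apply: evals_rec => // [|w x y k c vw _ yc].
  exact: evals_const.
by extend vw; apply: evals_add => //; apply: evals_var.
Qed.

Lemma evals_parity v e n : v ⊢ e ⇓ n -> v ⊢ Parity e ⇓ odd n.
Proof.
move=> en; have -> : (odd n : nat) = countdown n (fun _ c => c == 0) false.
  suff IH b : (b (+) odd n : nat) = countdown n (fun _ c => c == 0) b by rewrite -IH.
  elim: n b {en} => [|n IHn] b /=; first by rewrite addbF.
  by rewrite eqb0 -IHn; case: b; rewrite //= negbK.
apply: evals_rec => // [|w x y k c vw _ yc].
  exact: evals_const.
exact/evals_is_zero/evals_var.
Qed.
Lemma evals_pow v e1 e2 a b : v ⊢ e1 ⇓ a -> v ⊢ e2 ⇓ b ->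
  v ⊢ Pow e1 e2 ⇓ a ^ b.
Proof.
move=> ea eb; have -> : a ^ b = countdown b (fun _ c => c * a) 1.
  suff IH c : c * a ^ b = countdown b (fun _ c => c * a) c by rewrite -IH mul1n.
  elim: b c {eb} => [|b IHb] c /=; first by rewrite muln1.
  by rewrite -IHb expnS mulnA.
apply: evals_rec => // [|w x y k c vw _ yc].
  exact: evals_const.
by extend vw; apply: evals_mul => //; apply: evals_var.
Qed.

Lemma evals_eqn v e1 e2 a b : v ⊢ e1 ⇓ a -> v ⊢ e2 ⇓ b ->
  v ⊢ Eqn e1 e2 ⇓ (a == b).
Proof. by move=> ea eb; rewrite eqn_leq -mulnb; apply: evals_mul; apply: evals_le. Qed.

Lemma evals_half v e n : v ⊢ e ⇓ n -> v ⊢ Half e ⇓ n./2.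
Proof.
move=> en; have -> : n./2 = \sum_(0 <= k < n) odd k.
  elim: n {en} => [|n IHn]; first by rewrite big_geq.
  by rewrite big_nat_recr //= -IHn uphalf_half addnC.
by apply: evals_sum => // w x k vw xk; apply/evals_parity/evals_var.
Qed.
Lemma evals_mod v e1 e2 a b : 0 < b -> v ⊢ e1 ⇓ a -> v ⊢ e2 ⇓ b ->
  v ⊢ Mod e1 e2 ⇓ a %% b.
Proof.
move=> b0 ea eb.
have -> : a %% b = countdown a (fun _ c => c.+1 * ((c.+1 == b : nat) == 0)) 0.
  suff IH c : c < b -> (c + a) %% b
      = countdown a (fun _ c => c.+1 * ((c.+1 == b : nat) == 0)) c.
    by rewrite -IH.
  elim: a c {ea} => [|a IHa] c cb /=.
    by rewrite addn0 modn_small.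
  have [cE|cE] := eqVneq c.+1 b.
    by rewrite muln0 -IHa // addnS -addSn cE add0n modnDl.
  by rewrite muln1 -IHa; [rewrite addSnnS | rewrite ltn_neqAle cE].
apply: evals_rec => // [|w x y k c vw _ yc].
  exact: evals_const.
have ec := evals_succ (evals_var o yc).
by extend vw; apply: evals_mul => //; apply/evals_is_zero/evals_eqn.
Qed.

Lemma evals_pair v e1 e2 a b : v ⊢ e1 ⇓ a -> v ⊢ e2 ⇓ b ->
  v ⊢ Pair e1 e2 ⇓ Cantor.to_nat (a, b).
Proof.
move=> ea eb; have -> : Cantor.to_nat (a, b) = b + \sum_(0 <= k < b + a) k.+1.
  rewrite -[LHS]/(b + nat_rec _ 0 (fun i m => i.+1 + m) (b + a)).
  congr addn; elim: (b + a) => [|n IHn]; first by rewrite big_geq.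
  by rewrite big_nat_recr //= -IHn addnC.
apply: evals_add => //; apply: evals_sum => [|w x k vw xk]; first exact: evals_add.
exact/evals_succ/evals_var.
Qed.
Lemma sum_search (g : nat * nat -> nat) (h : nat -> nat -> nat) x y n :
  injective g -> g (x, y) = n -> x <= n -> y <= n ->
  \sum_(0 <= i < n.+1) \sum_(0 <= j < n.+1) h i j * (g (i, j) == n) = h x y.
Proof.
move=> g_inj gxy xn yn; rewrite big_mkord (bigD1 (inord x)) //=.
rewrite [X in _ + X]big1 ?addn0 => [|i ix].
  rewrite big_mkord (bigD1 (inord y)) //= [X in _ + X]big1 ?addn0 => [|j jy].
    by rewrite !inordK // gxy eqxx muln1.
  have [ij|_] := eqVneq; last by rewrite muln0.
  have [_ jE] := g_inj _ (x, y) (etrans ij (esym gxy)).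
  by rewrite -jE inord_val eqxx in jy.
rewrite big_mkord big1 // => j _.
have [ij|_] := eqVneq; last by rewrite muln0.
have [iE _] := g_inj _ (x, y) (etrans ij (esym gxy)).
by rewrite -iE inord_val eqxx in ix.
Qed.

Lemma Cantor_search (h : nat -> nat -> nat) n :
  \sum_(0 <= i < n.+1) \sum_(0 <= j < n.+1) h i j * (Cantor.to_nat (i, j) == n)
  = h (Cantor.of_nat n).1 (Cantor.of_nat n).2.
Proof.
have nE := Cantor.cancel_to_of n; move: (Cantor.of_nat n) nE => [x y] xyn.
have : y + x <= n by rewrite -xyn; exact/ssrnat.leP/Cantor.to_nat_non_decreasing.
by move=> le_n; apply: sum_search xyn _ _; [exact: Cantor.to_nat_inj | lia | lia].
Qed.

(** This covers both projections. *)
Lemma evals_search v (h : nat -> nat -> nat) e n es : v ⊢ e ⇓ n ->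
  (forall w x y i j, prefix v w -> holds w x i -> holds w y j ->
     evals o w (es x y) (h i j)) ->
  v ⊢ Sum (Succ e) (fun x => Sum (Succ e) (fun y =>
    Mul (es x y) (Eqn (Pair (Var x) (Var y)) e)))
  ⇓ h (Cantor.of_nat n).1 (Cantor.of_nat n).2.
Proof.
move=> en eh; rewrite -Cantor_search; apply: evals_sum => [|w x i vw xi].
  exact: evals_succ.
extend vw; apply: evals_sum => [|u y j wu yj]; first exact: evals_succ.
extend wu; apply: evals_mul; first by apply: eh => //; apply: prefix_trans wu.
by apply: evals_eqn => //; apply: evals_pair; apply: evals_var.
Qed.

Lemma evals_fst v e n : v ⊢ e ⇓ n -> v ⊢ Fst e ⇓ (Cantor.of_nat n).1.
Proof.
by move=> en; apply: (evals_search (h := fun i _ => i)) => // *; apply: evals_var.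
Qed.

Lemma evals_snd v e n : v ⊢ e ⇓ n -> v ⊢ Snd e ⇓ (Cantor.of_nat n).2.
Proof.
by move=> en; apply: (evals_search (h := fun _ j => j)) => // *; apply: evals_var.
Qed.

End Arithmetic.

(** The input is in register 1, so that the first free register is the output
  register 2. *)
Lemma machine_of_term e (F : (nat -> nat) -> nat -> nat) :
  (forall o n, evals o [:: n] e (F o n)) ->
  exists M, forall o n, outputs M o n (F o n).
Proof.
move=> eF; exists (program (e 2)) => o n.
by have /program_outputs := eF o n [:: n] (prefix_refl _).
Qed.
(** * The two programs *)

Ltac evaluate := repeat first
  [ assumption | apply: evals_const | apply: evals_var | apply: evals_fst
  | apply: evals_snd | apply: evals_succ | apply: evals_pred | apply: evals_pow
  | apply: evals_mod | apply: evals_pair | apply: evals_add | apply: evals_minus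
  | apply: evals_is_zero | apply: evals_parity | apply: evals_half
  | apply: evals_le | apply: evals_mul | apply: evals_oracle
  | let w := fresh "w" in let vw := fresh "vw" in
    apply: evals_sum => [|w ? ? vw ?]; [|extend vw] ].

(** Computation takes place in [nat]: the letter c stands for the difference of
  these two numbers ([decode_int_parts]). *)
Definition positive_part (c : nat) := ((odd c : nat) == 0) * c./2.
Definition negative_part (c : nat) := odd c * c./2.+1.

Definition PositivePart e := Mul (IsZero (Parity e)) (Half e).
Definition NegativePart e := Mul (Parity e) (Succ (Half e)).

Lemma decode_int_parts c :
  decode_int c = (Posz (positive_part c) - Posz (negative_part c))%R.
Proof.
rewrite /decode_int /positive_part /negative_part; case: (odd c).
  by rewrite mul0n mul1n sub0r NegzE.
by rewrite mul0n mul1n subr0.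
Qed.

Lemma code_int_parts (z : int) :
  z = (Posz (positive_part (code_int z)) - Posz (negative_part (code_int z)))%R.
Proof. by rewrite -decode_int_parts code_intK. Qed.

(** At least one of the two truncated differences is 0, and the code of -m is
  2m - 1 for positive m. *)
Lemma code_intB (a b : nat) :
  code_int (Posz a - Posz b)%R = 2 * (a - b) + (2 * (b - a)).-1.
Proof.
have [ab|ba] := leqP b a.
  rewrite subzn //=; lia.
have -> : (a%:Z - b%:Z)%R = Negz (b - a).-1 by lia.
rewrite /=; lia.
Qed.

Section Programs.
Variable p : nat.

(** The number of the pair (1/p^(n+1), j/p^(n+1)): the integers 1 and j have the
  codes 2 and 2j. *)
Definition digit_query (n j : nat) : nat :=
  Cantor.to_nat (Cantor.to_nat (2, n.+1), Cantor.to_nat (2 * j, n.+1)).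

Definition digit_output (o : nat -> nat) (n : nat) : nat :=
  let pos := \sum_(0 <= j < p) positive_part (o (digit_query n j)) in
  let neg := \sum_(0 <= j < p) negative_part (o (digit_query n j)) in
  2 * (pos - neg) + (2 * (neg - pos)).-1.

Definition DigitQuery j :=
  Pair (Pair (Const 2) (Succ (Var 1))) (Pair (Mul (Const 2) (Var j)) (Succ (Var 1))).

Definition Digit : term :=
  let pos := Sum (Const p) (fun j => PositivePart (Oracle (DigitQuery j))) in
  let neg := Sum (Const p) (fun j => NegativePart (Oracle (DigitQuery j))) in
  Add (Mul (Const 2) (Minus pos neg)) (Pred (Mul (Const 2) (Minus neg pos))).

Lemma holds_input n : holds [:: n] 1 n. Proof. by []. Qed.

Lemma evals_digit o n : evals o [:: n] Digit (digit_output o n).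
Proof. by have := holds_input n => ?; evaluate. Qed.

(** A natural number congruent modulo P to the integer with code c, because P - 1
  is congruent to -1. *)
Definition nat_residue (c P : nat) : nat := positive_part c + negative_part c * P.-1.
Definition NatResidue e P := Add (PositivePart e) (Mul (NegativePart e) (Pred P)).

(** Here n is the number of a pair of fractions with denominators p^k and p^l,
  brought to the common denominator P. Modulo P, y is the p-adic integer named
  by the oracle, and a and b are the residues of its products with the expanded
  numerators. The outputs 0 and 2 are the codes of the integers 0 and 1. *)
Definition carry_output (o : nat -> nat) (n : nat) : nat :=
  let u := (Cantor.of_nat n).1 in let v := (Cantor.of_nat n).2 in
  let k := (Cantor.of_nat u).2 in let l := (Cantor.of_nat v).2 in
  let P := p ^ (k + l) in
  let y := \sum_(0 <= i < k + l) nat_residue (o i) P * p ^ i in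
  let a := (nat_residue (Cantor.of_nat u).1 P * p ^ l * y) %% P in
  let b := (nat_residue (Cantor.of_nat v).1 P * p ^ k * y) %% P in
  2 * (P <= a + b).

Definition Carry : term :=
  let u := Fst (Var 1) in let v := Snd (Var 1) in
  let k := Snd u in let l := Snd v in
  let P := Pow (Const p) (Add k l) in
  let y := Sum (Add k l) (fun i =>
    Mul (NatResidue (Oracle (Var i)) P) (Pow (Const p) (Var i))) in
  let a := Mod (Mul (Mul (NatResidue (Fst u) P) (Pow (Const p) l)) y) P in
  let b := Mod (Mul (Mul (NatResidue (Fst v) P) (Pow (Const p) k)) y) P in
  Mul (Const 2) (Le P (Add a b)).

Lemma evals_carry o n : 0 < p -> evals o [:: n] Carry (carry_output o n).
Proof. by move=> p0; have := holds_input n => ?; evaluate; rewrite expn_gt0 p0. Qed.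
End Programs.

Local Open Scope ring_scope.
(** * The group of fractions with denominator a power of p *)

Section Localization.
Variable p : nat.
Hypothesis p_gt0 : (0 < p)%N.

Let pX_neq0 n : (p%:R : rat) ^+ n != 0.
Proof. by rewrite expf_neq0 // pnatr_eq0 -lt0n. Qed.

Lemma fracD z w n : frac p z n + frac p w n = frac p (z + w) n.
Proof. by apply: val_inj; rewrite /= -mulrDl rmorphD. Qed.

Lemma frac_widen z n m : frac p (z * p%:Z ^+ m) (n + m) = frac p z n.
Proof.
apply: val_inj => /=; rewrite exprD rmorphM rmorphXn /= -mulf_div divff ?mulr1 //.
Qed.

Lemma frac_mulrn z n m : frac p z n *+ m = frac p (z *+ m) n.
Proof.
elim: m => [|m IHm]; last by rewrite !mulrS IHm fracD.
by apply: val_inj; rewrite /= !mulr0n mul0r.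
Qed.

Lemma frac_mulrz z n : frac p 1 n *~ z = frac p z n.
Proof. by apply: val_inj; rewrite raddfMz /= -mulrzl mul1r. Qed.

Lemma frac1_mulrn n : frac p 1 n.+1 *+ p = frac p 1 n.
Proof.
by rewrite frac_mulrn -(frac_widen 1 n 1) addn1 expr1 mul1r natz.
Qed.

Lemma frac_eq z n w m : frac p z n = frac p w m ->
  z * p%:Z ^+ m = w * p%:Z ^+ n.
Proof.
move=> /(congr1 val) /= /eqP; rewrite eqr_div // => /eqP E; apply/eqP.
by rewrite -(eqr_int rat) !rmorphM !rmorphXn /= E.
Qed.

Lemma frac_cover (x : Zinv p) : exists z n, x = frac p z n.
Proof.
by case: x => x xP; have /asboolP[z [n xE]] := xP; exists z, n; apply: val_inj.
Qed.

Lemma integralE z n : (frac p z n \in @integral p) = (p%:Z ^+ n %| z)%Z.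
Proof.
rewrite unfold_in /=; apply/idP/idP => [/intrP[w E]|/dvdzP[w ->]].
  apply/dvdzP; exists w; apply/eqP; rewrite -(eqr_int rat) rmorphM rmorphXn /= -E.
  by rewrite divfK.
by rewrite rmorphM rmorphXn /= mulfK // intr_int.
Qed.

(** Two fractions with the same value have a common expansion by powers of p. *)
Lemma Zinv_elim (V : Type) (G : int -> nat -> V) :
  (forall z n, G (z * p%:Z) n.+1 = G z n) ->
  exists h : Zinv p -> V, forall z n, h (frac p z n) = G z n.
Proof.
move=> GS; have GX z n m : G (z * p%:Z ^+ m) (n + m)%N = G z n.
  elim: m => [|m IHm]; first by rewrite mulr1 addn0.
  by rewrite addnS exprSr mulrA GS.
have /choice[h hP] : forall x, exists v, forall z n, x = frac p z n -> v = G z n.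
  move=> x; have [z [n xE]] := frac_cover x; exists (G z n) => w m xE'.
  rewrite xE in xE'; rewrite -(GX z n m) -(GX w m n) (frac_eq xE').
  by rewrite addnC.
by exists h => z n; apply: hP.
Qed.

(** The group is the direct limit of copies of Z under multiplication by p. *)
Lemma Zinv_lift (V : zmodType) (e : nat -> V) :
  (forall n, e n.+1 *+ p = e n) ->
  exists2 h : Zinv p -> V, {morph h : x y / x + y}
    & forall z n, h (frac p z n) = e n *~ z.
Proof.
move=> eS; have [z n|h hE] := @Zinv_elim V (fun z n => e n *~ z).
  by rewrite mulrC mulrzA -pmulrn eS.
exists h => // x y; have [z [n ->]] := frac_cover x; have [w [m ->]] := frac_cover y.
by rewrite -(frac_widen z n m) -(frac_widen w m n) [(m + n)%N]addnC fracD !hE mulrzDr.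
Qed.
End Localization.

(** * Series of p-adic integers *)

Section Padic.
Variable p : nat.
Local Notation q n := (p%:Z ^+ n).

Lemma modz_sum_pow (a : nat -> int) n m : (n <= m)%N ->
  ((\sum_(i < m) a i * q i) %% q n)%Z = ((\sum_(i < n) a i * q i) %% q n)%Z.
Proof.
move=> /subnK <-; elim: (m - n)%N => [|k IHk]; first by rewrite add0n.
by rewrite addSn big_ord_recr /= -IHk exprD mulrA addrC modzMDl.
Qed.

Lemma padic_series_subproof (a : nat -> int) :
  (fun n => ((\sum_(i < n) a i * q i) %% q n)%Z) \in coherent p.
Proof. by apply/asboolP => n; rewrite modz_pow_succ (modz_sum_pow _ (leqnSn n)). Qed.

Definition padic_series (a : nat -> int) : padic p := Padic (padic_series_subproof a).

Lemma padic_names_series (a : nat -> int) : padic_names a (padic_series a).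
Proof. by move=> n; exists n => m nm; rewrite /= modz_sum_pow. Qed.

Lemma padic_namesE (a : nat -> int) x : padic_names a x -> x = padic_series a.
Proof. by move=> /padic_names_fun; apply; apply: padic_names_series. Qed.

Lemma padic_seriesD a b : padic_series (a \+ b) = padic_series a + padic_series b.
Proof.
apply/val_inj/funext => n /=; rewrite modzDm -big_split /=.
by congr (_ %% _)%Z; apply: eq_bigr => i _; rewrite mulrDl.
Qed.

Lemma padic_eqP (a : nat -> int) (x : padic p) :
  (forall n, (q n %| \sum_(i < n) a i * q i - x n)%Z) -> padic_series a = x.
Proof.
move=> H; apply/val_inj/funext => n /=; rewrite -(residue_mod x).
apply/eqP; rewrite eqz_mod_dvd; exact: H.
Qed.
End Padic.

(** * The extension of a group by the integers *)

(** The type mentions f only to select the addition twisted by f. *)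
Definition extension (C : zmodType) (f : cocycle C int) : Type := (int * C)%type.

Section Extension.
Variables (C : zmodType) (f : cocycle C int).

Lemma cocycle_axioms : [/\ f (0, 0) = 0, forall u v, f (u, v) = f (v, u)
  & forall u v w, f (u, v) + f (u + v, w) = f (v, w) + f (u, v + w)].
Proof. by case: f => g /= /asboolP. Qed.

Lemma cocycleC u v : f (u, v) = f (v, u).
Proof. by have [_ ->] := cocycle_axioms. Qed.

Lemma cocycleA u v w : f (u, v) + f (u + v, w) = f (v, w) + f (u, v + w).
Proof. by have [_ _ ->] := cocycle_axioms. Qed.

Lemma cocycle0 u : f (u, 0) = 0.
Proof.
have [f0 _ fA] := cocycle_axioms; have := fA u 0 0.
by rewrite !addr0 f0 add0r => /eqP; rewrite -subr_eq0 addrK => /eqP.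
Qed.

Local Notation extension := (extension f).
HB.instance Definition _ := Choice.on extension.

Definition ext_add (x y : extension) : extension :=
  (x.1 + y.1 + f (x.2, y.2), x.2 + y.2).
Definition ext_opp (x : extension) : extension := (- x.1 - f (- x.2, x.2), - x.2).

Lemma ext_addA : associative ext_add.
Proof.
move=> [a u] [b v] [c w]; congr pair; rewrite /= ?addrA //.
by rewrite -!addrA -cocycleA [f (u, v) + (c + _)]addrCA.
Qed.

Lemma ext_addC : commutative ext_add.
Proof.
by move=> [a u] [b v]; rewrite /ext_add /= cocycleC [a + b]addrC [u + v]addrC.
Qed.

Lemma ext_add0 : left_id ((0, 0) : extension) ext_add.
Proof.
by move=> [a u]; rewrite /ext_add /= cocycleC cocycle0 !add0r addr0.
Qed.

Lemma ext_addN : left_inverse ((0, 0) : extension) ext_opp ext_add.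
Proof. by move=> [a u]; rewrite /ext_add /= addNr addrAC subrK addNr. Qed.

HB.instance Definition _ :=
  GRing.isZmodule.Build extension ext_addA ext_addC ext_add0 ext_addN.

Definition ext_proj (x : extension) : C := x.2.

Lemma ext_proj_is_zmod_morphism : zmod_morphism ext_proj.
Proof. by []. Qed.

HB.instance Definition _ :=
  GRing.isZmodMorphism.Build extension C ext_proj ext_proj_is_zmod_morphism.

(** For n = p the sum on the right is a digit of f. *)
Lemma ext_mulrn (a : int) (u : C) n :
  ((a, u) : extension) *+ n = (a *+ n + \sum_(j < n) f (u, u *+ j), u *+ n).
Proof.
elim: n => [|n IHn]; first by rewrite big_ord0.
rewrite mulrS IHn big_ord_recr /= !mulrS; by congr pair; rewrite /= !addrA.
Qed.
End Extension.

(** * Fractional parts of multiples of a p-adic integer *)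

Section Phase.
Variable p : nat.
Hypothesis p_gt0 : (0 < p)%N.
Local Notation q n := (p%:Z ^+ n).

Let q_neq0 n : (q n) != 0.
Proof. by rewrite expf_neq0 //; lia. Qed.

Let qR_neq0 n : (q n)%:~R != 0 :> rat.
Proof. by rewrite intr_eq0. Qed.

Lemma phase_exists (x : padic p) : exists phi : Zinv p -> rat,
  forall z n, phi (frac p z n) = ((x n * z) %% q n)%Z%:~R / (q n)%:~R.
Proof.
apply: Zinv_elim => // z n; rewrite mulrA mulrC [_ * z * _]mulrC exprS.
rewrite -mulz_modr; last by lia.
rewrite -[in LHS]modzMml -coherentP !rmorphM /= invfM mulrACA mulVf ?mul1r 1?mulrC //.
by rewrite intr_eq0; lia.
Qed.

(** The fractional part of x a, for x a p-adic integer and a in Z[1/p]. *)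
Definition phase x := sval (cid (phase_exists x)).

Lemma phaseE x z n :
  phase x (frac p z n) = ((x n * z) %% q n)%Z%:~R / (q n)%:~R.
Proof. exact: (svalP (cid (phase_exists x))). Qed.

Lemma phase_int x a : a \in @integral p -> phase x a = 0.
Proof.
have [z [n ->]] := frac_cover a; rewrite integralE // => /dvdzP[w ->].
by rewrite phaseE mulrA modzMl mul0r.
Qed.

Lemma phase_congr x a b : a - b \in @integral p -> phase x a = phase x b.
Proof.
have [z [n ->]] := frac_cover a; have [w [m ->]] := frac_cover b.
rewrite -(frac_widen p_gt0 z n m) -(frac_widen p_gt0 w m n) [(m + n)%N]addnC.
set z' := z * _; set w' := w * _; set k := (n + m)%N.
have -> : frac p z' k - frac p w' k = frac p (z' - w') k.
  by apply/eqP; rewrite subr_eq fracD subrK.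
rewrite integralE // !phaseE => /dvdzP[d E].
have -> : z' = d * q k + w' by rewrite -E subrK.
by rewrite mulrDr mulrA modzMDl.
Qed.

Definition phase_num (x : padic p) z k l := ((x (k + l)%N * (z * q l)) %% q (k + l))%Z.

(** Over a common denominator P the three phases have numerators from 0 to P - 1, and
  the third is the sum of the other two modulo P. *)
Lemma phase_carry x z w k l :
  phase x (frac p z k) + phase x (frac p w l)
    - phase x (frac p z k + frac p w l)
  = ((phase_num x z k l + phase_num x w l k) %/ q (k + l))%Z%:~R.
Proof.
rewrite -(frac_widen p_gt0 z k l) -(frac_widen p_gt0 w l k) /phase_num.
rewrite [(l + k)%N]addnC fracD !phaseE mulrDr -modzDm.
set A := (_ %% _)%Z; set B := (_ %% _)%Z.
rewrite -mulrDl -mulrBl -rmorphD -rmorphB /= {1}(intdiv.divz_eq (A + B) (q (k + l))).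
by rewrite addrK rmorphM /= mulfK.
Qed.
End Phase.

(** * The series of a cocycle *)

Section Cocycles.
Variable p : nat.
Hypothesis p_gt0 : (0 < p)%N.
Local Notation qp n := (p%:Z ^+ n).
(* q is the identity or the projection onto the quotient by Z; s chooses
   representatives and need not be additive. *)
Variables (C : zmodType) (q : {additive Zinv p -> C}) (s : C -> Zinv p).
Hypothesis sK : cancel s q.
Hypothesis q_ker : forall a, q a = 0 -> a \in @integral p.

Definition inv_pow n := q (frac p 1 n).

Lemma inv_powS n : inv_pow n.+1 *+ p = inv_pow n.
Proof. by rewrite -raddfMn frac1_mulrn. Qed.

Lemma inv_pow_mulrn n j : inv_pow n *+ j = q (frac p j%:Z n).
Proof. by rewrite -raddfMn frac_mulrn // natz. Qed.

Definition digit (f : cocycle C int) n :=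
  \sum_(j < p) f (inv_pow n.+1, inv_pow n.+1 *+ j).

Definition series f := padic_series p (digit f).

(** If f is the coboundary of a rational function phi, then its n-th digit is
  p phi(t_(n+1)) - phi(t_n) with t_n = [inv_pow n]. *)
Lemma digit_telescope (f : cocycle C int) (phi : C -> rat) m :
  phi 0 = 0 -> (forall u v, (f (u, v))%:~R = phi u + phi v - phi (u + v)) ->
  (\sum_(i < m) digit f i * qp i)%:~R = phi (inv_pow m) * p%:R ^+ m - phi (inv_pow 0).
Proof.
move=> phi0 fE.
have mult u n : (\sum_(j < n) f (u, u *+ j))%:~R = phi u *+ n - phi (u *+ n).
  elim: n => [|n IHn]; first by rewrite big_ord0 !mulr0n phi0 subr0.
  rewrite big_ord_recr rmorphD /= IHn fE !mulrS; ring.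
elim: m => [|m IHm]; first by rewrite big_ord0 mulr1 subrr.
rewrite big_ord_recr rmorphD /= IHm rmorphM rmorphXn /= mult inv_powS exprS -pmulrn.
rewrite -[_ *+ p]mulr_natr; ring.
Qed.

Lemma phase_section x a : phase p_gt0 x (s (q a)) = phase p_gt0 x a.
Proof. by apply/phase_congr/q_ker; rewrite raddfB sK subrr. Qed.

(** By [phase_carry] the argument of [numq] is an integer. *)
Definition carry_fun x (uv : C * C) : int :=
  numq (phase p_gt0 x (s uv.1) + phase p_gt0 x (s uv.2)
        - phase p_gt0 x (s (uv.1 + uv.2))).

Lemma carry_funE x a b : (carry_fun x (q a, q b))%:~R =
  phase p_gt0 x a + phase p_gt0 x b - phase p_gt0 x (a + b).
Proof.
rewrite /carry_fun /= -raddfD !phase_section.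
have [z [k ->]] := frac_cover a; have [w [l ->]] := frac_cover b.
by rewrite phase_carry numq_int.
Qed.

Lemma phase0 x : phase p_gt0 x 0 = 0.
Proof. exact/phase_int/rpred0. Qed.

Lemma carry_subproof x : carry_fun x \in @cocycle_pred C int.
Proof.
apply/asboolP; split=> [|u v|u v w].
- apply/(@intr_inj rat); have := carry_funE x 0 0.
  by rewrite !raddf0 addr0 !phase0 subr0 addr0.
- by rewrite /carry_fun /= [v + u]addrC; congr numq; ring.
- apply/(@intr_inj rat); rewrite !rmorphD /= -(sK u) -(sK v) -(sK w).
  rewrite -!(raddfD q) !carry_funE.
  rewrite (addrA (s u)); ring.
Qed.

Definition carry x : cocycle C int := Cocycle (carry_subproof x).

Lemma carryE x z w k l :
  carry x (q (frac p z k), q (frac p w l))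
  = ((phase_num x z k l + phase_num x w l k) %/ qp (k + l))%Z.
Proof. by apply/(@intr_inj rat); rewrite carry_funE phase_carry. Qed.

(** The sums telescope with phi(1/p^n) = x_n/p^n, where x_n is the residue of x
  modulo p^n. *)
Lemma carry_series x : series (carry x) = x.
Proof.
apply: padic_eqP => n.
suff -> : \sum_(i < n) digit (carry x) i * qp i = x n by rewrite subrr dvdz0.
apply/(@intr_inj rat); rewrite (@digit_telescope _ (phase p_gt0 x \o s)) /=.
- rewrite !phase_section [phase _ _ (frac _ _ 0)]phase_int ?integralE ?dvd1z //.
  rewrite subr0 phaseE mulr1 residue_mod rmorphXn /= divfK //.
  by rewrite expf_neq0 // pnatr_eq0 -lt0n.
- by rewrite -(raddf0 q) phase_section phase0.
- move=> u v; rewrite -{1}(sK u) -{1}(sK v) carry_funE.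
  by rewrite -(phase_section x (_ + _)) raddfD !sK.
Qed.

Lemma coboundary_series (f : cocycle C int) (phi : C -> int) :
  phi 0 = 0 -> (forall u v, f (u, v) = phi u + phi v - phi (u + v)) ->
  series f = padic_of_int p (- phi (inv_pow 0)).
Proof.
move=> phi0 fE; apply: padic_eqP => n /=.
have -> : \sum_(i < n) digit f i * qp i = phi (inv_pow n) * qp n - phi (inv_pow 0).
  apply/(@intr_inj rat); rewrite (@digit_telescope _ (intr \o phi)) /=.
  - by rewrite rmorphB rmorphM rmorphXn.
  - by rewrite phi0.
  - by move=> u v; rewrite fE rmorphB rmorphD.
by rewrite -eqz_mod_dvd modz_mod modzMDl.
Qed.

(** Since the series is z, the n-th partial sum is z + c_n p^n. The elements
  e_n = (-c_n, t_n) of the extension satisfy p e_(n+1) = e_n and define a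
  homomorphism h from Z[1/p] to the extension. Under either alternative h
  factors through q and yields an additive section; its integer components are
  the values of -phi for a function phi with coboundary f. *)
Lemma series_coboundary (f : cocycle C int) z :
  series f = padic_of_int p z ->
  injective q \/ inv_pow 0 = 0 /\ z = 0 -> f \in @coboundary C int.
Proof.
move=> fz q_inj.
have c_ex n : exists c, \sum_(i < n) digit f i * qp i = z + c * qp n.
  have /eqP := congr1 (fun x : padic p => x n) fz.
  rewrite /= eqz_mod_dvd => /dvdzP[c E]; exists c; rewrite -E; ring.
have [c cE] := choice c_ex.
have cS n : c n.+1 *+ p = c n + digit f n.
  have := cE n.+1; rewrite big_ord_recr /= cE exprS => E.
  have qn0 : qp n != 0 by rewrite expf_neq0 //; lia.
  apply: (mulIf qn0); rewrite -mulr_natr natz; move: E; lia.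
pose e n : extension f := (- c n, inv_pow n).
have eS n : e n.+1 *+ p = e n.
  by rewrite /e ext_mulrn inv_powS -/(digit f n) mulNrn cS opprD subrK.
have [h hD hE] := Zinv_lift p_gt0 eS.
have h_proj a : ext_proj (h a) = q a.
  have [w [n ->]] := frac_cover a.
  by rewrite hE raddfMz /= -(frac_mulrz _ w n) raddfMz.
have h0 : h 0 = 0 by apply: (addrI (h 0)); rewrite -hD !addr0.
have h_congr a b : q a = q b -> h a = h b.
  case: q_inj => [inj_q /inj_q -> //|[inv_pow0 z0] ab].
  have abZ : a - b \in @integral p by apply: q_ker; rewrite raddfB ab subrr.
  have [w wE] : exists w, a - b = frac p w 0.
    move: abZ; have [w [n ->]] := frac_cover (a - b).
    rewrite integralE // => /dvdzP[d ->]; exists d.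
    by rewrite -(frac_widen p_gt0 d 0 n).
  have e0 : e 0%N = 0.
    have := cE 0%N; rewrite big_ord0 z0 add0r mulr1 /e inv_pow0 => <-.
    by rewrite oppr0.
  by rewrite -[a](subrK b) hD wE hE e0 mul0rz add0r.
apply/asboolP; exists (fun u => - (h (s u)).1) => [|u v].
  by rewrite (h_congr _ 0) ?sK ?raddf0 // h0 oppr0.
have /(congr1 fst) /= <- : h (s u) + h (s v) = h (s (u + v)).
  by rewrite -hD; apply: h_congr; rewrite raddfD !sK.
rewrite -[(h (s u)).2]/(ext_proj (h (s u))) -[(h (s v)).2]/(ext_proj (h (s v))).
rewrite !h_proj !sK; lia.
Qed.
End Cocycles.

(** * The isomorphisms *)

Lemma PoszX m n : Posz (m ^ n) = Posz m ^+ n.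
Proof. by elim: n => // n IHn; rewrite expnS PoszM exprS IHn. Qed.

Lemma nat_residueE c P : (0 < P)%N ->
  (Posz (nat_residue c P) = decode_int c %[mod P])%Z.
Proof.
move=> P0.
have -> : Posz (nat_residue c P) = Posz (negative_part c) * Posz P + decode_int c.
  rewrite decode_int_parts /nat_residue; case: P P0 => // P _ /=.
  rewrite PoszD PoszM intS; ring.
by rewrite modzMDl.
Qed.

Section Isomorphism.
Variable p : nat.
Hypothesis p_gt0 : (0 < p)%N.
Local Notation qp n := (p%:Z ^+ n).
Variables (C : zmodType) (q : {additive Zinv p -> C}) (s : C -> Zinv p).
Hypothesis sK : cancel s q.
Hypothesis q_ker : forall a, q a = 0 -> a \in @integral p.
Variable nu : numbering C.
Hypothesis nuE : forall n, nu n = q (Zinv_element p n).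

Local Notation carry := (carry p_gt0 sK q_ker).
Local Notation series := (series q).

Lemma numbered_pairE i j : numbered_pair nu (Cantor.to_nat (i, j)) =
  (q (Zinv_element p i), q (Zinv_element p j)).
Proof. by rewrite /numbered_pair Cantor.cancel_of_to !nuE. Qed.

Lemma digit_outputE (f : cocycle C int) n :
  digit_output p (fun k => code_int (f (numbered_pair nu k))) n
  = code_int (digit q f n).
Proof.
have dE j : numbered_pair nu (digit_query n j) = (inv_pow q n.+1, inv_pow q n.+1 *+ j).
  rewrite numbered_pairE /Zinv_element !Cantor.cancel_of_to inv_pow_mulrn //.
  by rewrite mul2n -[(j.*2)%N]/(code_int j) code_intK.
rewrite /digit_output -code_intB; congr code_int.
rewrite !big_mkord !(big_morph Posz PoszD (erefl _)) -sumrB.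
by apply: eq_bigr => j _; rewrite dE -code_int_parts.
Qed.

Lemma carry_outputE a x n : padic_names a x ->
  carry_output p (fun k => code_int (a k)) n = code_int (carry x (numbered_pair nu n)).
Proof.
move=> ax; rewrite /carry_output /numbered_pair.
case: (Cantor.of_nat n) => i j; rewrite !nuE /Zinv_element /=.
case: (Cantor.of_nat i) => u k; case: (Cantor.of_nat j) => v l /=.
set P := (p ^ (k + l))%N; set y := (\sum_(0 <= _ < _) _)%N.
have P0 : (0 < P)%N by rewrite expn_gt0 p_gt0.
have PE : qp (k + l) = P by rewrite PoszX.
have yE : (Posz y = x (k + l)%N %[mod P])%Z.
  rewrite (padic_namesE ax) /= PE modz_mod /y big_mkord.
  rewrite (big_morph Posz PoszD (erefl _)); apply/eqP; rewrite eqz_mod_dvd.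
  rewrite -sumrB; apply: (big_ind (fun t => (P %| t)%Z)) => // [t t'|m _].
    exact: rpredD.
  rewrite -eqz_mod_dvd PoszM -modzMml nat_residueE // code_intK modzMml.
  by rewrite PoszX.
have num c m : Posz ((nat_residue c P * p ^ m * y) %% P) =
    ((x (k + l)%N * (decode_int c * qp m)) %% P)%Z.
  rewrite -modz_nat !PoszM PoszX -modzMmr yE modzMmr -mulrA.
  by rewrite -modzMml nat_residueE // modzMml mulrA mulrC.
rewrite -[carry_fun _ _ _ _]/(carry x (_, _)) carryE /phase_num.
rewrite [(l + k)%N]addnC PE -!num //.
set A := (_ %% P)%N; set B := (_ %% P)%N.
have AP : (A < P)%N by rewrite ltn_mod.
have BP : (B < P)%N by rewrite ltn_mod.
(* A and B are below P, so the quotient is 0 or 1. *)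
have -> : ((Posz A + Posz B) %/ P)%Z = Posz (P <= A + B)%N; last by rewrite mul2n.
rewrite -PoszD divz_nat; congr Posz.
have [PAB|ABP] := leqP P (A + B); last by rewrite divn_small.
have -> : (A + B = P + (A + B - P))%N by lia.
by rewrite divnDl // divnn P0 divn_small //; lia.
Qed.

Variables (T : zmodType) (r : {additive padic p -> T}).
Hypothesis r_onto : forall y, exists x, r x = y.
(* The alternatives hold for Z[1/p] with Z_p/Z and for Z(p^oo) with Z_p. *)
Hypothesis kernels :
  (injective q /\ forall x, r x = 0 <-> exists z, x = padic_of_int p z) \/
  (inv_pow q 0 = 0 /\ injective r).

Lemma Ext_class_eq (f g : cocycle C int) :
  Ext_class f = Ext_class g <-> f - g \in @coboundary C int.
Proof.
rewrite Quotient.idealrBE; split=> [fg|/eqP //].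
exact/eqP.
Qed.

Lemma seriesD f g : series (f + g) = series f + series g.
Proof.
rewrite /series -padic_seriesD; congr padic_series; apply/funext => n.
by rewrite /digit /= -big_split.
Qed.

Lemma seriesB f g : series (f - g) = series f - series g.
Proof. by apply/eqP; rewrite eq_sym subr_eq -seriesD subrK. Qed.

(** Either r kills the integers, or 1 is 0 in C and phi vanishes there. *)
Lemma reduce_int_defect (phi : C -> int) :
  phi 0 = 0 -> r (padic_of_int p (- phi (inv_pow q 0))) = 0.
Proof.
case: kernels => [[_ r_ker] _|[-> _] ->]; first by apply/r_ker; eexists.
by rewrite oppr0 -[padic_of_int p 0]/(0 : padic p) raddf0.
Qed.

Lemma series_kernel f : r (series f) = 0 <-> f \in @coboundary C int.
Proof.
split=> [|/asboolP[phi phi0 fE]]; last first.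
  by rewrite (coboundary_series p_gt0 q phi0 fE) reduce_int_defect.
case: kernels => [[q_inj r_ker] /r_ker[z fz]|[inv_pow0 r_inj] rf].
  by apply: (series_coboundary p_gt0 sK q_ker fz); left.
have fz : series f = padic_of_int p 0.
  by apply: r_inj; rewrite rf; apply/esym; exact: (raddf0 r).
by apply: (series_coboundary p_gt0 sK q_ker fz); right.
Qed.

Lemma series_Ext f g : r (series f) = r (series g) <-> Ext_class f = Ext_class g.
Proof.
rewrite Ext_class_eq -series_kernel seriesB raddfB; split=> [->|/eqP].
  by rewrite subrr.
by rewrite subr_eq0 => /eqP.
Qed.

Variable names_T : (nat -> int) -> T -> Prop.
Hypothesis names_TE : forall a y, names_T a y <-> exists2 x, r x = y & padic_names a x.
Hypothesis names_T_fun : forall a x y, names_T a x -> names_T a y -> x = y.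
Hypothesis names_T_onto : forall x, exists a, names_T a x.

(** The series gives an injective homomorphism F' from Ext to T, and F, which sends
  y to the class of the carry cocycle of some x over y, is a right inverse.
  Hence F is additive and is independent of the choice of x, which is why the
  carries computed from an arbitrary name of y represent F y. *)
Lemma padic_Ext_isomorphic :
  computably_isomorphic (Representation int_coding names_T_fun names_T_onto)
    (Ext_representation nu int_coding).
Proof.
have [lift liftK] := choice r_onto.
pose F y : Ext C int := Ext_class (carry (lift y)).
pose F' (e : Ext C int) := r (series (repr e)).
have F'E f : F' (Ext_class f) = r (series f).
  by apply/series_Ext; rewrite /Ext_class reprK.
have Ext_classK (e : Ext C int) : Ext_class (repr e) = e by rewrite /Ext_class reprK.
have FK : cancel F F' by move=> y; rewrite F'E carry_series liftK.
have F'K : cancel F' F.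
  by move=> e; rewrite -[RHS]Ext_classK; apply/series_Ext; rewrite carry_series liftK.
have FB : zmod_morphism F.
  move=> y z; rewrite -[RHS]F'K; congr F.
  rewrite -(Ext_classK (F y)) -(Ext_classK (F z)).
  have -> : Ext_class (repr (F y)) - Ext_class (repr (F z))
          = Ext_class (repr (F y) - repr (F z)) by rewrite /Ext_class raddfB.
  by rewrite F'E seriesB raddfB -/(F' _) -/(F' _) !FK.
have F_carry x : F (r x) = Ext_class (carry x).
  by apply/series_Ext; rewrite !carry_series liftK.
pose Fa : {additive T -> Ext C int} := HB.pack F (GRing.isZmodMorphism.Build _ _ F FB).
exists Fa, F'; split => //.
  have [M MP] := machine_of_term (fun o n => @evals_carry p o n p_gt0).
  exists M => a y /names_TE[x <- ax].
  exists (fun n => carry x (numbered_pair nu n)).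
    by exists (carry x); rewrite ?[Fa _]F_carry.
  by move=> n; have := MP (fun k => code_int (a k)) n; rewrite (carry_outputE _ ax).
have [M MP] := machine_of_term (@evals_digit p).
exists M => a e [f <- aE]; exists (digit q f).
  by rewrite F'E; apply/names_TE; exists (series f) => //; apply: padic_names_series.
move=> n; have := MP (fun k => code_int (a k)) n.
by rewrite (_ : a = fun k => f (numbered_pair nu k)) ?digit_outputE //; apply/funext.
Qed.
End Isomorphism.

Theorem mainTheorem1 (p : nat) (p_prime : prime p) :
  computably_isomorphic (padic_representation p)
    (Ext_representation (prufer_numbering p) int_coding) /\
  computably_isomorphic (padic_mod_int_representation p)
    (Ext_representation (Zinv_numbering p) int_coding).
Proof.
have p_gt0 := prime_gt0 p_prime; split.
- pose q : {additive Zinv p -> prufer p} := \pi_(Quotient.quot (@integral p))%qT.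
  have q_ker a : q a = 0 -> a \in @integral p.
    move=> qa; rewrite -[a]subr0 Quotient.idealrBE; apply/eqP.
    by rewrite -[LHS]/(q a) qa -[RHS]/(q 0) raddf0.
  apply: (@padic_Ext_isomorphic p p_gt0 _ q repr _ q_ker _ _ _ idfun).
  + exact: reprK.
  + by [].
  + by move=> x; exists x.
  + right; split=> //; rewrite /inv_pow -[RHS](raddf0 q) /q; apply/eqP.
    by rewrite -Quotient.idealrBE subr0 integralE // dvd1z.
  + by move=> a y; split=> [ay|[x <-]] //; exists y.
- pose q : {additive Zinv p -> Zinv p} := idfun.
  pose r : {additive padic p -> padic_mod_int p} :=
    \pi_(Quotient.quot (@padic_int p))%qT.
  apply: (@padic_Ext_isomorphic p p_gt0 _ q id _ _ _ _ _ r).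
  + by [].
  + by move=> a /= ->; apply: rpred0.
  + by [].
  + by move=> y; exists (repr y); apply: reprK.
  + left; split=> [? ?|x] //.
    have -> : r x = 0 <-> x \in @padic_int p.
      rewrite -[x in X in _ <-> X]subr0 Quotient.idealrBE.
      rewrite -[0 in X in X <-> _](raddf0 r).
      by split=> [/eqP|/eqP].
    by split=> /asboolP.
  + by move=> a y; split=> [[x ? ?]|[x ? ?]]; exists x.
Qed.
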